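(* Let $G$ be a countable tournament. Then there exist a countable linearly ordered set $\mathcal Q$ and pairwise vertex-disjoint nonempty induced subtournaments $\{G_i\}_{i\in\mathcal Q}$ of $G$ such that $G=\bigoplus_{i\in\mathcal Q}G_i$ and each $G_i$ is irreducible. Furthermore, this decomposition is unique up to order isomorphism of $\mathcal Q$: if $G$ is isomorphic to $\bigoplus_{j\in\mathcal Q'}G'_j$ with $\mathcal Q'$ a countable linearly ordered set and each $G'_j$ a nonempty irreducible tournament, then there is an order isomorphism $\phi:\mathcal Q\to\mathcal Q'$ such that $G_i\cong G'_{\phi(i)}$ for all $i\in\mathcal Q$.
   Context: A tournament is a digraph without loops in which for every two distinct vertices $u,v$ exactly one of $(u,v),(v,u)$ is an edge; countable means finite or countably infinite vertex set. For a countable linearly ordered set $\mathcal Q$ and countable tournaments $G_i$, $\bigoplus_{i\in\mathcal Q}G_i$ is the tournament on $\bigsqcup_iV(G_i)$ with edge set $\bigcup_iE(G_i)\cup\bigcup_{i<j}\{(v,w):v\in V(G_i),w\in V(G_j)\}$. A countable tournament $G$ is reducible if there exist nonempty vertex-disjoint induced subtournaments $G_1,G_2$ with $V(G_1)\cup V(G_2)=V(G)$ and $G=G_1\oplus G_2$; otherwise it is irreducible. *)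

(* Defs.v *)
From HB Require Import structures.
From mathcomp Require Import all_boot all_order.
From mathcomp Require Import boolp classical_sets functions cardinality.

Set Implicit Arguments.
Unset Strict Implicit.
Unset Printing Implicit Defensive.

Import Order.TTheory.
Local Open Scope classical_set_scope.
Local Open Scope order_scope.

Record tournament := Tournament {
  vertex :> Type;
  edge : vertex -> vertex -> Prop;
  edge_irrefl : forall u, ~ edge u u;
  edge_exactly_one : forall u v, u <> v ->
    (edge u v /\ ~ edge v u) \/ (edge v u /\ ~ edge u v) }.

Definition countable_tournament (G : tournament) : Prop :=
  countable [set: G].

Definition is_tournament_iso (G H : tournament) (f : G -> H) : Prop :=
  bijective f /\ forall u v, edge (f u) (f v) <-> edge u v.

Definition isomorphic (G H : tournament) : Prop :=
  exists f : G -> H, is_tournament_iso f.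

Section Induced.
Variables (G : tournament) (A : set G).

Definition induced_edge (x y : set_type A) : Prop := edge (\val x) (\val y).

Lemma induced_edge_irrefl x : ~ induced_edge x x.
Proof. exact: edge_irrefl. Qed.

Lemma induced_edge_exactly_one x y : x <> y ->
  (induced_edge x y /\ ~ induced_edge y x) \/
  (induced_edge y x /\ ~ induced_edge x y).
Proof. by move=> xy; apply: edge_exactly_one => /val_inj. Qed.

Definition induced : tournament :=
  Tournament induced_edge_irrefl induced_edge_exactly_one.

End Induced.

Section OrderedSum.
Variables (d : Order.disp_t) (Q : orderType d) (G_ : Q -> tournament).

Inductive osum_edge : {i : Q & G_ i} -> {i : Q & G_ i} -> Prop :=
| osum_edge_same i (u v : G_ i) :
    edge u v -> osum_edge (existT _ i u) (existT _ i v)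
| osum_edge_lt i j (u : G_ i) (v : G_ j) :
    i < j -> osum_edge (existT _ i u) (existT _ j v).

Lemma osum_edgeP p q : osum_edge p q <->
  tag p < tag q \/ (tag p = tag q /\ edge (tagged p) (tagged_as p q)).
Proof.
split.
  case=> [i u v uv|i j u v ij]; last by left.
  by right; split=> //; rewrite (tagged_asE (u := Tagged G_ u) v).
case: p q => [i u] [j v] /= [ij|[ij]]; first exact: osum_edge_lt.
subst j; rewrite (tagged_asE (u := Tagged G_ u) v); exact: osum_edge_same.
Qed.

Lemma osum_edge_irrefl p : ~ osum_edge p p.
Proof.
move/osum_edgeP; rewrite ltxx => -[//|[_]].
case: p => i u /=; rewrite (tagged_asE (u := Tagged G_ u) u); exact: edge_irrefl.
Qed.

Lemma osum_edge_exactly_one p q : p <> q ->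
  (osum_edge p q /\ ~ osum_edge q p) \/ (osum_edge q p /\ ~ osum_edge p q).
Proof.
case: p q => [i u] [j v] pq; rewrite !osum_edgeP /=.
case: (ltgtP i j) => [ij|ji|ij].
- by left; split; [left|case=> // -[eji]; rewrite eji ltxx in ij].
- by right; split; [left|case=> // -[eij]; rewrite eij ltxx in ji].
subst j.
rewrite (tagged_asE (u := Tagged G_ u) v) (tagged_asE (u := Tagged G_ v) u) /=.
have uv : u <> v by move=> uv; apply: pq; rewrite uv.
by case: (edge_exactly_one uv) => -[e ne]; [left|right];
  split; [right|case=> // -[]|right|case=> // -[]].
Qed.

Definition osum : tournament :=
  Tournament osum_edge_irrefl osum_edge_exactly_one.

End OrderedSum.

(* [G] is the sum of its induced subtournaments on the sets [V i], as an       *)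
(* equality on the vertex set of [G] itself: the inclusion of the disjoint     *)
(* union of the [V i] into [G] is an isomorphism.                              *)
Definition is_internal_osum (G : tournament) (d : Order.disp_t)
    (Q : orderType d) (V : Q -> set G) : Prop :=
  is_tournament_iso
    (fun p : osum (fun i => induced (V i)) => \val (tagged p) : G).

(* The binary sum is indexed by [bool], ordered by [false < true]. *)
Definition reducible (G : tournament) : Prop :=
  exists A B : set G,
    [/\ A !=set0, B !=set0, A `&` B = set0, A `|` B = [set: G] &
        is_internal_osum (fun b : bool => if b then B else A)].

Definition irreducible (G : tournament) : Prop := ~ reducible G.

Definition is_irreducible_decomposition (G : tournament) (d : Order.disp_t)
    (Q : orderType d) (V : Q -> set G) : Prop :=
  [/\ countable [set: Q],
      trivIset [set: Q] V,
      (forall i, V i !=set0),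
      is_internal_osum V &
      forall i, irreducible (induced (V i))].

Definition is_order_iso (d d' : Order.disp_t) (Q : orderType d)
    (Q' : orderType d') (phi : Q -> Q') : Prop :=
  bijective phi /\ {mono phi : i j / i <= j}.

(* Main.v *)
Require Import Defs.
From HB Require Import structures.
From mathcomp Require Import all_boot all_order.
From mathcomp Require Import boolp classical_sets functions cardinality.

(** The summands are the strongly connected components: a tournament is
    irreducible exactly when every vertex reaches every other one, because the
    vertices lying outside a set closed under out-edges beat all those inside.
    Reachability is a total preorder, so the components form a chain.  In any
    decomposition into irreducible summands, [u] reaches [v] iff the index of
    [u] is at most that of [v]; hence the order type of the index set and the
    summands are determined by [G]. *)

Import Order.TTheory.
Local Open Scope order_scope.
Local Open Scope classical_set_scope.

Set Implicit Arguments.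
Unset Strict Implicit.
Unset Printing Implicit Defensive.

Lemma inj_surj_bijective (S T : Type) (f : S -> T) :
  injective f -> (forall y, exists x, f x = y) -> bijective f.
Proof.
move=> f_inj /choice[g fK]; exists g => // x.
by apply: f_inj; rewrite fK.
Qed.

Lemma isomorphic_sym (G H : tournament) : isomorphic G H -> isomorphic H G.
Proof.
move=> [f [[g fK gK] fE]]; exists g; split; first by exists f.
by move=> u v; rewrite -fE !gK.
Qed.

(** * Reachability and irreducibility *)

Section Reachability.
Variable G : tournament.
Implicit Types (D : set G) (u v w : G).

Definition edge_closed D := forall u v, D u -> edge u v -> D v.

(* Impredicative form of the reflexive transitive closure of [edge]. *)
Definition reach u v := forall D, edge_closed D -> D u -> D v.

Lemma edge_asym u v : edge u v -> ~ edge v u.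
Proof.
move=> uv vu; have [e|/edge_exactly_one[[]|[]]//] := EM (u = v).
by move: uv; rewrite e; apply: edge_irrefl.
Qed.

Lemma edge_closed_out D u v : edge_closed D -> D u -> ~ D v -> edge v u.
Proof.
move=> Dcl Du nDv; have uv : u <> v by move=> uv; rewrite -uv in nDv.
by case: (edge_exactly_one uv) => -[// e _]; case: nDv; apply: Dcl e.
Qed.

Lemma reach_refl u : reach u u.
Proof. by []. Qed.

Lemma reach_trans u v w : reach u v -> reach v w -> reach u w.
Proof. by move=> uv vw D Dcl /(uv D Dcl)/(vw D Dcl). Qed.

Lemma edge_reach u v : edge u v -> reach u v.
Proof. by move=> uv D Dcl /Dcl; apply. Qed.

Lemma not_reach_edge u v : ~ reach u v -> edge v u.
Proof.
move=> nuv; apply: contrapT => nvu; apply: nuv => D Dcl Du.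
by apply: contrapT => /(edge_closed_out Dcl Du).
Qed.

Lemma reach_total u v : reach u v \/ reach v u.
Proof. by have [|/not_reach_edge/edge_reach] := EM (reach u v); [left|right]. Qed.

(** Serves both for splitting a reducible tournament in two and for the sum of all components.
    Asymmetry of [edge] excludes edges against the order of the indices. *)
Lemma is_internal_osum_fibers (d : Order.disp_t) (Q : orderType d)
    (V : Q -> set G) (t : G -> Q) :
  (forall i u, V i u <-> t u = i) -> (forall u v, t u < t v -> edge u v) ->
  is_internal_osum V.
Proof.
move=> VP tE; have tP i (x : induced (V i)) : t (\val x) = i.
  exact/VP/set_mem/valP.
split.
  apply: inj_surj_bijective.
    move=> [i x] [j y] /= xy.
    have ij : i = j by rewrite -(tP _ x) -(tP _ y) /= xy.
    by subst j; rewrite (val_inj xy).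
  move=> u; have Vu : u \in V (t u) by rewrite inE; apply/VP.
  by exists (existT (fun i => induced (V i)) (t u) (Sub u Vu)).
move=> [i x] [j y] /=; split.
  case: (ltgtP i j) => [ij xy|ji xy|ij xy].
  - exact: (@osum_edge_lt _ _ (fun i => induced (V i))).
  - by case: (edge_asym xy); apply: tE; rewrite !tP.
  - by subst j; apply: (@osum_edge_same _ _ (fun i => induced (V i))).
move=> /osum_edgeP /= [ij|[ij]]; first by apply: tE; rewrite !tP.
subst j.
by rewrite (tagged_asE (u := Tagged (fun i => induced (V i)) x) y).
Qed.

(** If [u] misses [v], the vertices that [u] misses beat those it reaches and so form the first
    summand. Conversely, no edge leaves the last summand of a splitting. *)
Lemma irreducibleP : irreducible G <-> forall u v, reach u v.
Proof.
split=> [irr u v|Gr [A [B [[a Aa] [b Bb] meetAB joinAB [_ sumE]]]]].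
  apply: contrapT => nuv; apply: irr.
  exists (~` reach u), (reach u); split.
  - by exists v.
  - by exists u.
  - exact: setICl.
  - exact: setvU.
  apply: (@is_internal_osum_fibers _ _ _ (fun w => `[< reach u w >])).
    by move=> [] w; split; [exact: asboolT|move/asboolP|exact: asboolF|
                            move/negbT/asboolP].
  move=> x y; case: asboolP => nx; case: asboolP => uy // _.
  apply: not_reach_edge => yx; apply: nx; exact: reach_trans uy yx.
(* [reducible] states these with the lattice operations of [set G]. *)
have AB0 : A `&` B = set0 := meetAB.
have AB1 : A `|` B = [set: G] := joinAB.
have Bcl : edge_closed B.
  move=> x y Bx xy.
  have : (A `|` B) y by rewrite AB1.
  case=> // Ay; case: (edge_asym xy).
  have y' : y \in (if false then B else A) by rewrite inE.
  have x' : x \in (if true then B else A) by rewrite inE.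
  pose p b z (zb : z \in (if b then B else A)) : osum _ :=
    existT (fun b : bool => induced (if b then B else A)) b (Sub z zb).
  apply: (proj2 (sumE (p false y y') (p true x x'))); exact: osum_edge_lt.
have : (A `&` B) a by split=> //; apply: Gr Bcl Bb.
by rewrite AB0.
Qed.

End Reachability.

(** * The chain of strong components *)

Section Components.
Variable G : tournament.

(** A component is encoded by the set of all vertices reachable from it, which mutually reachable
    vertices share; its own vertices form [component_set]. *)
Definition component : Type := set_type (range (@reach G)).

HB.instance Definition _ := Choice.on component.

Definition component_of (u : G) : component :=
  Sub (reach u) (mem_set (imageT (@reach G) u)).

(** Inclusion is reversed because earlier components reach more vertices. *)
Definition component_le (C D : component) : bool := `[< \val D `<=` \val C >].

Lemma component_ofP (C : component) : exists u, component_of u = C.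
Proof.
by case: (set_mem (valP C)) => u _ uC; exists u; apply/val_inj.
Qed.

Lemma component_le_of (u v : G) :
  component_le (component_of u) (component_of v) <-> reach u v.
Proof.
split=> [/asboolP|uv]; first by apply; apply: reach_refl.
by apply/asboolP => w; apply: reach_trans.
Qed.

Lemma component_le_refl : reflexive component_le.
Proof. by move=> C; apply/asboolP. Qed.

Lemma component_le_anti : antisymmetric component_le.
Proof.
by move=> C D /andP[/asboolP DC /asboolP CD]; apply/val_inj/seteqP.
Qed.

Lemma component_le_trans : transitive component_le.
Proof.
move=> C B D /asboolP CB /asboolP DC; apply/asboolP.
exact: subset_trans DC CB.
Qed.

Lemma component_le_total : total component_le.
Proof.
move=> C D; have [u <-] := component_ofP C; have [v <-] := component_ofP D.
by apply/orP; case: (reach_total u v) => /component_le_of; [left|right].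
Qed.

Fact component_display : Order.disp_t. Proof. exact: Order.Disp tt tt. Qed.

HB.instance Definition _ := Order.Le_isPOrder.Build component_display component
  component_le_refl component_le_anti component_le_trans.

HB.instance Definition _ :=
  Order.POrder_isTotal.Build component_display component component_le_total.

Definition component_set (C : component) : set G :=
  [set u | component_of u = C].

Lemma component_eq (u v : G) :
  component_of u = component_of v <-> reach u v /\ reach v u.
Proof.
rewrite -!component_le_of; split=> [->|[uv vu]].
  by rewrite component_le_refl.
by apply: component_le_anti; rewrite uv.
Qed.

Lemma component_irreducible (C : component) :
  irreducible (induced (component_set C)).
Proof.
apply/irreducibleP => x y D Dcl Dx.
have Cx : component_of (\val x) = C := set_mem (valP x).
have Cy : component_of (\val y) = C := set_mem (valP y).
have /component_eq[xy yx] : component_of (\val x) = component_of (\val y).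
  by rewrite Cx Cy.
(* Vertices above the component are added to [D] to make it closed in [G]. *)
pose D' w := reach (\val x) w /\
  forall z : induced (component_set C), \val z = w -> D z.
have [] : D' (\val y); last by move=> _; apply.
apply: xy; last by split=> [|z /val_inj->].
move=> w w' [xw Dw] ww'; split; first exact: reach_trans xw (edge_reach ww').
move=> z zw'.
have Cz : component_of (\val z) = C := set_mem (valP z).
have /component_eq[xz zx] : component_of (\val x) = component_of (\val z).
  by rewrite Cx Cz.
(* No edge re-enters the component from outside: [w] is reached from [x] and reaches [x] back
   through [z]. *)
have Cw : w \in component_set C.
  rewrite inE /component_set /= -Cx; apply/component_eq; split=> //.
  by apply: reach_trans zx; rewrite zw'; apply: edge_reach.
apply: (Dcl (Sub w Cw)); first exact: Dw.
by rewrite -zw' in ww'.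
Qed.

Lemma component_decomposition :
  countable_tournament G -> is_irreducible_decomposition component_set.
Proof.
move=> Gc; split.
- suff -> : [set: component] = component_of @` [set: G].
    exact: sub_countable (card_image_le _ _) Gc.
  apply/seteqP; split=> // C _.
  by have [u <-] := component_ofP C; exists u.
- by move=> C D _ _ [u [/= <- <-]].
- exact: component_ofP.
- apply: (@is_internal_osum_fibers _ _ _ _ component_of) => // u v.
  rewrite ltNge => /negP nvu; apply: not_reach_edge => /component_le_of.
  exact: nvu.
- exact: component_irreducible.
Qed.

End Components.

(** * Sums of irreducible tournaments, seen through the index map *)

Section Uniqueness.
Variables (G : tournament) (d : Order.disp_t) (Q : orderType d).
Variables (H : Q -> tournament) (h : G -> osum H).
Hypothesis h_iso : is_tournament_iso h.

Lemma iso_osum_index_surj :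
  (forall i, [set: H i] !=set0) -> forall i, exists u, tag (h u) = i.
Proof.
have [[g hK gK] _] := h_iso.
by move=> H0 i; have [x _] := H0 i; exists (g (existT _ i x)); rewrite gK.
Qed.

(** Edges never lower the index, so the vertices of index at least that of [u] form a closed set.
    Conversely, a smaller index gives an edge, and equal indices are handled by irreducibility of
    the common summand. *)
Lemma reach_index : (forall i, irreducible (H i)) ->
  forall u v, reach u v <-> tag (h u) <= tag (h v).
Proof.
have [[g hK gK] hE] := h_iso.
move=> Hirr u v; split.
  move/(_ [set w | tag (h u) <= tag (h w)]); apply=> //=.
  move=> w w' /= uw /hE/osum_edgeP[/ltW|[<-//]]; exact: le_trans.
rewrite le_eqVlt => /orP[/eqP huv|huv]; last first.
  by apply: edge_reach; apply/hE/osum_edgeP; left.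
move=> D Dcl Du; rewrite -(hK v); rewrite -(hK u) in Du.
case: (h u) (h v) huv Du => [i x] [j y] /= ij; subst j => Dx.
have /irreducibleP Hr := Hirr i.
(* The trace on [H i] of a closed set of [G] is closed. *)
apply: (Hr x y [set z | D (g (existT _ i z))]) Dx => z z' /= Dz zz'.
by apply: Dcl Dz _; apply/hE; rewrite !gK; apply: osum_edge_same.
Qed.

Lemma isomorphic_index_fiber (i : Q) :
  isomorphic (H i) (induced [set u | tag (h u) = i]).
Proof.
have [[g hK gK] hE] := h_iso.
have gP x : g (existT _ i x) \in [set u | tag (h u) = i] by rewrite inE /= gK.
exists (fun x => Sub (g (existT _ i x)) (gP x)); split.
  apply: inj_surj_bijective.
    move=> x y /(congr1 \val) /= /(can_inj gK) xy.
    exact: (eq_from_Tagged (T_ := H)).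
  case=> u ui; have /= hu := set_mem ui.
  case hue: (h u) hu => [j y] /= ji; subst j.
  by exists y; apply/val_inj; rewrite /= -hue hK.
move=> x y; rewrite /= /induced_edge /= -hE !gK; split=> [|xy].
  move=> /osum_edgeP[|[_]] /=; first by rewrite ltxx.
  by rewrite (tagged_asE (u := Tagged H x) y).
exact: osum_edge_same.
Qed.

End Uniqueness.

(** Inverting the inclusion map puts an internal decomposition in the same form as an external one,
    so that the index map results apply to both. *)
Lemma internal_osum_index (G : tournament) (d : Order.disp_t) (Q : orderType d)
    (V : Q -> set G) : is_internal_osum V ->
  exists2 h : G -> osum (fun i => induced (V i)), is_tournament_iso h &
    forall i, V i = [set u | tag (h u) = i].
Proof.
case=> -[h hK gK] gE; exists h.
  split; first exact: Bijective gK hK.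
  by move=> u v; rewrite -gE !gK.
move=> i; apply/seteqP; split=> u /=.
  move=> /mem_set Vu.
  by have -> := hK (existT (fun i => induced (V i)) i (Sub u Vu)).
by move=> <-; rewrite -[X in V _ X]gK; apply/set_mem/valP.
Qed.

(** Both orders are the quotient of [T] by the same total preorder. *)
Lemma order_iso_of_index (T : Type) (d d' : Order.disp_t) (Q : orderType d)
    (Q' : orderType d') (t : T -> Q) (t' : T -> Q') :
  (forall i, exists u, t u = i) -> (forall j, exists u, t' u = j) ->
  (forall u v, t u <= t v <-> t' u <= t' v) ->
  exists2 phi : Q -> Q', is_order_iso phi & forall u, phi (t u) = t' u.
Proof.
move=> /choice[s sK] t'surj tt'.
(* The choice of the section [s] does not matter: elements with equal [t] are equivalent for the
   preorder, hence have equal [t']. *)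
have phiE u : t' (s (t u)) = t' u.
  by apply: le_anti; apply/andP; split; apply/tt'; rewrite sK.
have phi_mono : {mono (t' \o s) : i j / i <= j}.
  move=> i j /=; rewrite -[in RHS](sK i) -[in RHS](sK j).
  by apply/idP/idP => /tt'.
exists (t' \o s) => //; split=> //.
apply: inj_surj_bijective; first exact: inc_inj.
by move=> j; have [u <-] := t'surj j; exists (t u); apply: phiE.
Qed.

Theorem theorem3p7 (G : tournament) (hG : countable_tournament G) :
  (exists (d : Order.disp_t) (Q : orderType d) (V : Q -> set G),
      is_irreducible_decomposition V) /\
  (forall (d : Order.disp_t) (Q : orderType d) (V : Q -> set G),
      is_irreducible_decomposition V ->
    forall (d' : Order.disp_t) (Q' : orderType d') (G' : Q' -> tournament),
      countable [set: Q'] ->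
      (forall j, countable_tournament (G' j)) ->
      (forall j, [set: G' j] !=set0) ->
      (forall j, irreducible (G' j)) ->
      isomorphic G (osum G') ->
    exists phi : Q -> Q',
      is_order_iso phi /\ forall i, isomorphic (induced (V i)) (G' (phi i))).
Proof.
split.
  by do 3!eexists; apply: component_decomposition.
move=> d Q V [_ _ V0 /internal_osum_index[h h_iso VE] Virr].
move=> d' Q' G' _ _ G'0 G'irr [f f_iso].
have h_surj : forall i, exists u, tag (h u) = i.
  by move=> i; have [u] := V0 i; rewrite VE; exists u.
have [|phi phi_iso phiE] :=
    order_iso_of_index h_surj (iso_osum_index_surj f_iso G'0).
  (* Both index comparisons express [reach], which depends on [G] alone. *)
  by move=> u v; rewrite -(reach_index h_iso Virr) -(reach_index f_iso G'irr).
exists phi; split=> // i; apply: isomorphic_sym.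
(* As [phi] is injective and carries one index map to the other, the two decompositions cut [G] into
   the very same vertex sets. *)
have -> : V i = [set u | tag (f u) = phi i].
  rewrite VE; apply/seteqP; split=> u /=; first by move<-.
  by rewrite -phiE; case: phi_iso => -[psi phiK _] _ /(can_inj phiK).
exact: isomorphic_index_fiber.
Qed.
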